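(* Let $\mathcal{X},\mathcal{Y},\mathcal{Z}$ be topological spaces, let $k,l,m$ be kernels (real-valued symmetric positive definite functions) on $\mathcal{X},\mathcal{Y},\mathcal{Z}$ respectively, and let $(X_i,Y_i,Z_i)_{i=1}^n$, $n\ge 1$, be sample points in $\mathcal{X}\times\mathcal{Y}\times\mathcal{Z}$. Let $\hat P_{XYZ}$ be the empirical measure of the sample and $$\Delta_L\hat P=\hat P_{XYZ}-\hat P_{XY}\hat P_Z-\hat P_{YZ}\hat P_X-\hat P_{XZ}\hat P_Y+2\hat P_X\hat P_Y\hat P_Z .$$ Let $K,L,M$ be the $n\times n$ Gram matrices $K_{ij}=k(X_i,X_j)$, $L_{ij}=l(Y_i,Y_j)$, $M_{ij}=m(Z_i,Z_j)$, and let $\tilde K=HKH$, $\tilde L=HLH$, $\tilde M=HMH$, where $H=I-\frac1n\mathbf{1}\mathbf{1}^\top$. Then $$\left\Vert \Delta_L\hat P\right\Vert_{k\otimes l\otimes m}^2=\frac{1}{n^2}\left(\tilde K\circ\tilde L\circ\tilde M\right)_{++}.$$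
   Context: $\mathbf{1}$ is the $n\times 1$ column of ones and $I$ the $n\times n$ identity matrix. $\circ$ denotes the Hadamard (entrywise) product of matrices, and $A_{++}=\sum_{i=1}^n\sum_{j=1}^n A_{ij}$ is the sum of all entries of an $n\times n$ matrix $A$. A kernel on a set is a symmetric function $k$ with $\sum_{i,j}a_ia_jk(x_i,x_j)\ge0$ for all finite families of real $a_i$ and points $x_i$. The product kernel is $(k\otimes l\otimes m)\big((x,y,z),(x',y',z')\big)=k(x,x')\,l(y,y')\,m(z,z')$. For a kernel $\kappa$ on a space and a finite signed measure $\nu$ on it whose kernel embedding $\mu_\kappa(\nu)=\int\kappa(\cdot,w)\,d\nu(w)$ in the reproducing kernel Hilbert space $\mathcal H_\kappa$ exists, $\|\nu\|_\kappa^2:=\|\mu_\kappa(\nu)\|_{\mathcal H_\kappa}^2=\iint\kappa(w,w')\,d\nu(w)\,d\nu(w')$. For finitely supported $\nu$ (as here) these integrals are finite sums. The empirical measure is $\hat P_{XYZ}=\frac1n\sum_{i=1}^n\delta_{(X_i,Y_i,Z_i)}$. $\hat P_{XY},\hat P_{YZ},\hat P_{XZ},\hat P_X,\hat P_Y,\hat P_Z$ are its marginals, e.g. $\hat P_{XY}=\frac1n\sum_i\delta_{(X_i,Y_i)}$ and $\hat P_Z=\frac1n\sum_i\delta_{Z_i}$. Products such as $\hat P_{XY}\hat P_Z$ are product measures, regarded as measures on $\mathcal X\times\mathcal Y\times\mathcal Z$ with each variable in its own coordinate (e.g. $\hat P_{XZ}\hat P_Y=\frac1{n^2}\sum_{i,j}\delta_{(X_i,Y_j,Z_i)}$).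 *)

(* Defs.v *)
From HB Require Import structures.
From mathcomp Require Import all_boot all_order all_algebra.
From mathcomp Require Import all_classical all_reals all_analysis.

Set Implicit Arguments.
Unset Strict Implicit.
Unset Printing Implicit Defensive.

Import Order.TTheory GRing.Theory Num.Theory.
Import numFieldNormedType.Exports.

Local Open Scope classical_set_scope.
Local Open Scope ring_scope.

Definition is_kernel (R : realType) (T : Type) (k : T -> T -> R) : Prop :=
  (forall s t, k s t = k t s) /\
  (forall (p : nat) (a : 'I_p -> R) (x : 'I_p -> T),
     0 <= \sum_(i < p) \sum_(j < p) a i * a j * k (x i) (x j)).

Definition tensor3 (R : realType) (X Y Z : Type)
    (k : X -> X -> R) (l : Y -> Y -> R) (m : Z -> Z -> R)
    (p q : X * Y * Z) : R :=
  k p.1.1 q.1.1 * l p.1.2 q.1.2 * m p.2 q.2.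

(* A reproducing kernel Hilbert space of kappa, as a set of functions on W.
   [rkhs_dot] is only meaningful on [rkhs_fun]; nothing is assumed about its
   values elsewhere. *)
Record rkhs (R : realType) (W : Type) (kappa : W -> W -> R) := Rkhs {
  rkhs_fun : set (W -> R) ;
  rkhs_dot : (W -> R) -> (W -> R) -> R ;
  _ : rkhs_fun (fun=> 0) ;
  _ : forall (a : R) f g, rkhs_fun f -> rkhs_fun g ->
        rkhs_fun (fun w => a * f w + g w) ;
  _ : forall (a : R) f g h, rkhs_fun f -> rkhs_fun g -> rkhs_fun h ->
        rkhs_dot (fun w => a * f w + g w) h = a * rkhs_dot f h + rkhs_dot g h ;
  _ : forall f g, rkhs_fun f -> rkhs_fun g -> rkhs_dot f g = rkhs_dot g f ;
  _ : forall f, rkhs_fun f -> 0 <= rkhs_dot f f ;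
  _ : forall f, rkhs_fun f -> rkhs_dot f f = 0 -> f = fun=> 0 ;
  (* completeness *)
  _ : forall u : nat -> W -> R, (forall i, rkhs_fun (u i)) ->
        (forall e : R, 0 < e -> exists N : nat, forall i j : nat,
           (N <= i)%N -> (N <= j)%N ->
           Num.sqrt (rkhs_dot (u i - u j) (u i - u j)) < e) ->
        exists2 f, rkhs_fun f &
          (fun i => Num.sqrt (rkhs_dot (u i - f) (u i - f))) @ \oo --> (0 : R) ;
  (* kappa(., w) is in the space and represents evaluation at w *)
  _ : forall w, rkhs_fun (kappa^~ w) ;
  _ : forall f w, rkhs_fun f -> rkhs_dot f (kappa^~ w) = f w
}.

Definition rkhs_norm (R : realType) (W : Type) (kappa : W -> W -> R)
    (H : rkhs kappa) (f : W -> R) : R :=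
  Num.sqrt (rkhs_dot H f f).

(* Finitely supported signed measures are represented by real-valued set
   functions on all subsets.  Using the full powerset as sigma-algebra avoids
   any measurability condition on the kernels, and makes the integral against
   such a measure a finite sum over its atoms.  On set functions that are not
   finitely supported signed measures, [fsint] is a junk value. *)
Definition fsint (R : realType) (T : choiceType) (nu : set T -> R)
    (f : T -> R) : R :=
  \sum_(t \in [set: T]) f t * nu [set t].

Definition point_mass (R : realType) (T : Type) (t : T) (A : set T) : R :=
  \1_A t.

Definition empirical (R : realType) (T : Type) (n : nat) (s : 'I_n -> T)
    (A : set T) : R :=
  n%:R^-1 * \sum_(i < n) point_mass R (s i) A.

Definition push (R : realType) (T U : Type) (g : T -> U) (nu : set T -> R)
    (A : set U) : R :=
  nu (g @^-1` A).

Definition prod_meas (R : realType) (T U : choiceType)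
    (mu : set T -> R) (nu : set U -> R) (A : set (T * U)) : R :=
  fsint mu (fun t => nu (xsection A t)).

Definition embedding (R : realType) (W : choiceType) (kappa : W -> W -> R)
    (nu : set W -> R) (w : W) : R :=
  fsint nu (kappa w).

Section Lancaster.
Variables (R : realType) (X Y Z : choiceType) (P : set (X * Y * Z) -> R).

Definition marg_XY : set (X * Y) -> R := push (fun p => (p.1.1, p.1.2)) P.
Definition marg_YZ : set (Y * Z) -> R := push (fun p => (p.1.2, p.2)) P.
Definition marg_XZ : set (X * Z) -> R := push (fun p => (p.1.1, p.2)) P.
Definition marg_X : set X -> R := push (fun p => p.1.1) P.
Definition marg_Y : set Y -> R := push (fun p => p.1.2) P.
Definition marg_Z : set Z -> R := push (fun p => p.2) P.

(* Each product measure is transported to X * Y * Z by the evident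
   permutation of coordinates. *)
Definition lancaster (A : set (X * Y * Z)) : R :=
  P A
  - prod_meas marg_XY marg_Z A
  - push (fun q : Y * Z * X => (q.2, q.1.1, q.1.2))
      (prod_meas marg_YZ marg_X) A
  - push (fun q : X * Z * Y => (q.1.1, q.2, q.1.2))
      (prod_meas marg_XZ marg_Y) A
  + 2 * prod_meas (prod_meas marg_X marg_Y) marg_Z A.

End Lancaster.

Definition gram (R : realType) (T : Type) (n : nat) (k : T -> T -> R)
    (x : 'I_n -> T) : 'M[R]_n :=
  \matrix_(i, j) k (x i) (x j).

Definition centering (R : realType) (n : nat) : 'M[R]_n :=
  1%:M - n%:R^-1 *: ((const_mx 1 : 'cV[R]_n) *m (const_mx 1 : 'cV[R]_n)^T).

Definition centered (R : realType) (n : nat) (A : 'M[R]_n) : 'M[R]_n :=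
  centering R n *m A *m centering R n.

Definition hadamard (R : realType) (n : nat) (A B : 'M[R]_n) : 'M[R]_n :=
  map2_mx *%R A B.

Definition sum_entries (R : realType) (n : nat) (A : 'M[R]_n) : R :=
  \sum_(i < n) \sum_(j < n) A i j.

(* Main.v *)
(* With h the centering matrix, the Lancaster interaction of the empirical
   measure factorizes as
     n^-1 sum_a sum_(i,j,k) h_ai h_aj h_ak delta_(x_i, y_j, z_k),
   because sum_i h_ai g_i = g_a - (mean of g): expanding the three centerings
   gives the five Lancaster terms, the last with coefficient 3 - 1 = 2.
   Its squared norm is a double sum over a, b whose summand splits into the
   product of the (a, b) entries of the three centered Gram matrices. *)

Require Import Defs.
From mathcomp Require Import all_boot all_order all_algebra.
From mathcomp Require Import all_classical all_reals all_analysis.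
From mathcomp Require Import ring.

Import GRing.Theory Num.Theory.

Local Open Scope ring_scope.

Lemma sum_pair (V : nmodType) (I J : finType) (F : I * J -> V) :
  \sum_p F p = \sum_i \sum_j F (i, j).
Proof. by rewrite pair_bigA; apply: eq_bigr => -[]. Qed.

(** The points [s i] may coincide. [fsint] visits a repeated atom once, with the total of its
    coefficients as mass; exchanging the sums over atoms and indices recovers one term per index. *)
Lemma fsint_atomic (R : realType) (T : choiceType) (I : finType) (c : I -> R)
    (s : I -> T) (nu : set T -> R) (f : T -> R) :
  (forall A, nu A = \sum_i c i * point_mass R (s i) A) ->
  fsint nu f = \sum_i c i * f (s i).
Proof.
(* [r] lists every atom once; off [r] all the point masses vanish, so the finitely supported sum is
   a sum over [r]. *)
move=> nuE; pose r := undup (map s (index_enum I)).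
have s_r i : s i \in r by rewrite mem_undup map_f // mem_index_enum.
rewrite /fsint (@fsbigE _ _ _ _ _ r) ?undup_uniq //; last first.
  move=> t _ tr; rewrite nuE big1 ?mulr0 // => i _.
  rewrite /point_mass indicE memNset ?mulr0 //= => sit.
  by rewrite -sit s_r in tr.
under eq_bigl do rewrite in_setT.
under eq_bigr do rewrite nuE mulr_sumr.
rewrite /= exchange_big /=; apply: eq_bigr => i _.
(* Exactly one entry of [r] equals [s i], and only there is the mass nonzero. *)
rewrite (bigD1_seq (s i)) ?undup_uniq ?s_r //= big1 => [|t sit].
  by rewrite /point_mass indicE mem_set //= mulr1 addr0 mulrC.
by rewrite /point_mass indicE memNset ?mulr0 //= => /esym/eqP; apply/negP.
Qed.

Lemma fsint_empirical (R : realType) (T : choiceType) (n : nat)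
    (s : 'I_n -> T) (f : T -> R) :
  fsint (empirical R s) f = n%:R^-1 * \sum_i f (s i).
Proof.
rewrite mulr_sumr; apply: fsint_atomic => A.
by rewrite /empirical mulr_sumr.
Qed.

Lemma point_mass_xsection (R : realType) (T U : Type) (t : T) (u : U)
    (A : set (T * U)) :
  point_mass R u (xsection A t) = point_mass R (t, u) A.
Proof. by rewrite /point_mass !indicE mem_xsection. Qed.

Lemma prod_meas_empirical (R : realType) (T U : choiceType) (n : nat)
    (s : 'I_n -> T) (t : 'I_n -> U) (A : set (T * U)) :
  prod_meas (empirical R s) (empirical R t) A
  = n%:R^-1 * \sum_i n%:R^-1 * \sum_j point_mass R (s i, t j) A.
Proof.
rewrite /prod_meas fsint_empirical; congr (_ * _); apply: eq_bigr => i _.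
by rewrite /empirical; under eq_bigr do rewrite point_mass_xsection.
Qed.

(** The inner product measure is again atomic, indexed by pairs with constant weight
    [n%:R^-1 * n%:R^-1], so [fsint_atomic] applies to the outer product. *)
Lemma prod_meas_empirical3 (R : realType) (T U V : choiceType) (n : nat)
    (s : 'I_n -> T) (t : 'I_n -> U) (v : 'I_n -> V) (A : set (T * U * V)) :
  prod_meas (prod_meas (empirical R s) (empirical R t)) (empirical R v) A
  = n%:R^-1 * \sum_i n%:R^-1 * \sum_j n%:R^-1 *
      \sum_k point_mass R (s i, t j, v k) A.
Proof.
rewrite {1}/prod_meas.
rewrite (@fsint_atomic _ _ _ (fun=> n%:R^-1 * n%:R^-1)
  (fun p : 'I_n * 'I_n => (s p.1, t p.2))) => [|B]; last first.
  rewrite prod_meas_empirical mulr_sumr sum_pair /=.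
  by apply: eq_bigr => i _; rewrite mulrA mulr_sumr.
rewrite mulr_sumr sum_pair /=.
apply: eq_bigr => i _; rewrite mulrA mulr_sumr; apply: eq_bigr => j _.
by congr (_ * (_ * _)); apply: eq_bigr => k _; exact: point_mass_xsection.
Qed.

Lemma centeringE (R : realType) (n : nat) (i j : 'I_n) :
  centering R n i j = (i == j)%:R - n%:R^-1.
Proof. by rewrite !mxE big_ord1 !mxE !mulr1. Qed.

Lemma sum_centering (R : realType) (n : nat) (a : 'I_n) (g : 'I_n -> R) :
  \sum_i centering R n a i * g i = g a - n%:R^-1 * \sum_i g i.
Proof.
under eq_bigr do rewrite centeringE mulrBl.
rewrite sumrB -mulr_sumr (bigD1 a) //= eqxx mul1r big1 ?addr0 // => i.
by rewrite eq_sym => /negPf ->; rewrite mul0r.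
Qed.

Lemma centeredE (R : realType) (n : nat) (A : 'M[R]_n) (a b : 'I_n) :
  centered A a b
  = \sum_i \sum_j centering R n a i * centering R n b j * A i j.
Proof.
rewrite mxE exchange_big /=; apply: eq_bigr => j _.
rewrite mxE mulr_suml; apply: eq_bigr => i _.
(* The centering matrix is symmetric, which lets its right-hand copy be read along row [b]. *)
by rewrite !centeringE (eq_sym j b); ring.
Qed.

(** By linearity and the reproducing property, pairing the kernel combination with any [g] in the
    space gives the sum of the [c i * g (s i)]; then [g] is taken to be the combination itself. *)
Lemma rkhs_norm_atomic (R : realType) (W : Type) (kappa : W -> W -> R)
    (H : rkhs kappa) (I : finType) (c : I -> R) (s : I -> W) :
  rkhs_norm H (fun w => \sum_i c i * kappa w (s i)) ^+ 2
  = \sum_i \sum_j c i * c j * kappa (s i) (s j).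
Proof.
rewrite /rkhs_norm.
case: H => F dot F0 FD dotD dotC dot_ge0 _ _ Fk dotk /=.
(* Linearity of [dot] is available only on [F], so membership comes first. Induction on lists fits
   the closure axiom, which adds one term [a * f] at a time. *)
have Fsum (r : seq I) : F (fun w => \sum_(i <- r) c i * kappa w (s i)).
  elim: r => [|i r IH].
    by rewrite (_ : (fun w => _) = fun=> 0) //; apply/funext => w; rewrite big_nil.
  rewrite (_ : (fun w => _) =
    fun w => c i * kappa w (s i) + \sum_(i <- r) c i * kappa w (s i)).
    exact: FD.
  by apply/funext => w; rewrite big_cons.
(* Linearity applied to [1 * 0 + 0] gives [d = d + d]. *)
have dot0 g : F g -> dot (fun=> 0) g = 0.
  move=> Fg; have := dotD 1 _ _ _ F0 F0 Fg.
  rewrite mul1r addr0 mul1r => /esym/eqP.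
  by rewrite -subr_eq0 addrK => /eqP.
have dot_suml (r : seq I) g : F g ->
    dot (fun w => \sum_(i <- r) c i * kappa w (s i)) g
    = \sum_(i <- r) c i * g (s i).
  move=> Fg; elim: r => [|i r IH].
    rewrite big_nil (_ : (fun w => _) = fun=> 0) ?dot0 //.
    by apply/funext => w; rewrite big_nil.
  rewrite (_ : (fun w => _) =
    fun w => c i * kappa w (s i) + \sum_(i <- r) c i * kappa w (s i)).
    by rewrite dotD // IH big_cons dotC // dotk.
  by apply/funext => w; rewrite big_cons.
rewrite sqr_sqrtr ?dot_ge0 // dot_suml //.
by apply: eq_bigr => i _; rewrite mulr_sumr; apply: eq_bigr => j _; rewrite mulrA.
Qed.

Lemma lancaster_empirical (R : realType) (X Y Z : choiceType) (n : nat)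
    (x : 'I_n -> X) (y : 'I_n -> Y) (z : 'I_n -> Z) (A : set (X * Y * Z)) :
  (0 < n)%N ->
  lancaster (empirical R (fun i => (x i, y i, z i))) A
  = n%:R^-1 * \sum_a \sum_i centering R n a i * \sum_j centering R n a j *
      \sum_k centering R n a k * point_mass R (x i, y j, z k) A.
Proof.
(* For fixed [A], the claim becomes an identity between sums of the real array [q]. *)
move=> n_gt0; pose q i j k := point_mass R (x i, y j, z k) A.
have n_neq0 : n%:R != 0 :> R by rewrite pnatr_eq0 -lt0n.
have -> : lancaster (empirical R (fun i => (x i, y i, z i))) A
  = n%:R^-1 * \sum_i q i i i
    - n%:R^-1 * (\sum_i n%:R^-1 * \sum_j q i i j)
    - n%:R^-1 * (\sum_i n%:R^-1 * \sum_j q j i i)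
    - n%:R^-1 * (\sum_i n%:R^-1 * \sum_j q i j i)
    + 2 * (n%:R^-1 * \sum_i n%:R^-1 * \sum_j n%:R^-1 * \sum_k q i j k).
  (* Marginals of the empirical measure are, by conversion, empirical measures of projected samples,
     and the coordinate permutations merely relabel atoms. *)
  rewrite /lancaster; congr (_ - _ - _ - _ + 2 * _).
  - exact: prod_meas_empirical.
  - exact: prod_meas_empirical.
  - exact: prod_meas_empirical.
  - exact: prod_meas_empirical3.
transitivity (n%:R^-1 * \sum_a
  (q a a a - n%:R^-1 * (\sum_k q a a k)
   - n%:R^-1 * (\sum_j (q a j a - n%:R^-1 * (\sum_k q a j k)))
   - n%:R^-1 * (\sum_i (q i a a - n%:R^-1 * (\sum_k q i a k)
      - n%:R^-1 * (\sum_j (q i j a - n%:R^-1 * (\sum_k q i j k))))))); last first.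
  congr (_ * _); apply: eq_bigr => a _.
  rewrite sum_centering; congr (_ - _ * _).
    rewrite sum_centering sum_centering; congr (_ - _ * _).
    by apply: eq_bigr => j _; rewrite sum_centering.
  apply: eq_bigr => i _.
  rewrite sum_centering sum_centering; congr (_ - _ * _).
  by apply: eq_bigr => j _; rewrite sum_centering.
have avg_cst (c : R) : \sum_(a < n) c = n%:R * c.
  by rewrite sumr_const card_ord mulr_natl.
(* Separates differences lying under two binders, once the outer sum has been distributed; [sum3B]
   does so under three. *)
have sum2B (c : R) (F G : 'I_n -> 'I_n -> R) :
    \sum_i \sum_j (F i j - c * G i j)
    = \sum_i \sum_j F i j - c * \sum_i \sum_j G i j.
  rewrite mulr_sumr -sumrB; apply: eq_bigr => i _.
  by rewrite mulr_sumr -sumrB.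
have sum3B (c : R) (F G : 'I_n -> 'I_n -> 'I_n -> R) :
    \sum_i \sum_j \sum_k (F i j k - c * G i j k)
    = \sum_i \sum_j \sum_k F i j k - c * \sum_i \sum_j \sum_k G i j k.
  rewrite mulr_sumr -sumrB; apply: eq_bigr => i _; exact: sum2B.
rewrite !(sumrB, =^~ mulr_sumr).
rewrite !sum2B sum3B.
(* All triple sums are brought to one form, the two permuted ones by exchanging sums. The term free
   of [a] was summed [n] times by the outer sum; [field] cancels that factor using [n_neq0]. *)
have -> : \sum_a \sum_i \sum_k q i a k = \sum_i \sum_j \sum_k q i j k.
  exact: exchange_big.
have -> : \sum_a \sum_i \sum_j q i j a = \sum_i \sum_j \sum_k q i j k.
  by rewrite exchange_big; apply: eq_bigr => i _; exact: exchange_big.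
rewrite avg_cst.
have -> : \sum_i \sum_j n%:R^-1 * (\sum_k q i j k)
    = n%:R^-1 * \sum_i \sum_j \sum_k q i j k.
  by rewrite mulr_sumr; apply: eq_bigr => i _; rewrite mulr_sumr.
by field.
Qed.

(** Matches a product of three matrix entries, each a sum over its own index, with a sum over the
    atoms, which are indexed by triples. *)
Lemma mul3_sum (R : comPzRingType) (I : finType) (f g h : I -> R) :
  (\sum_i f i) * (\sum_i g i) * (\sum_i h i)
  = \sum_(p : I * I * I) f p.1.1 * g p.1.2 * h p.2.
Proof.
rewrite big_distrlr mulr_suml !sum_pair /=; apply: eq_bigr => i _.
by rewrite mulr_suml; apply: eq_bigr => j _; rewrite mulr_sumr.
Qed.

Theorem proposition3 (R : realType) (X Y Z : topologicalType)
    (k : X -> X -> R) (l : Y -> Y -> R) (m : Z -> Z -> R)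
    (hk : is_kernel k) (hl : is_kernel l) (hm : is_kernel m)
    (n : nat) (hn : (1 <= n)%N)
    (x : 'I_n -> X) (y : 'I_n -> Y) (z : 'I_n -> Z)
    (H : rkhs (tensor3 k l m)) :
  rkhs_norm H (embedding (tensor3 k l m)
    (lancaster (empirical R (fun i => (x i, y i, z i))))) ^+ 2
  = (n%:R ^+ 2)^-1 *
    sum_entries (hadamard (hadamard (centered (gram k x))
                                    (centered (gram l y)))
                          (centered (gram m z))).
Proof.
pose h := centering R n.
pose u a (p : 'I_n * 'I_n * 'I_n) := h a p.1.1 * h a p.1.2 * h a p.2.
pose s (p : 'I_n * 'I_n * 'I_n) := (x p.1.1, y p.1.2, z p.2).
(* [c p] is the mass that index [p] contributes at [s p] to the Lancaster measure, so the embedding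
   is a finite kernel combination. *)
pose c p := n%:R^-1 * \sum_a u a p.
have -> : embedding (tensor3 k l m)
    (lancaster (empirical R (fun i => (x i, y i, z i))))
  = fun w => \sum_p c p * tensor3 k l m w (s p).
  apply/funext => w; apply: fsint_atomic => A.
  rewrite lancaster_empirical // mulr_sumr.
  under [RHS]eq_bigr do rewrite /c mulr_sumr mulr_suml.
  rewrite exchange_big; apply: eq_bigr => a _.
  rewrite !sum_pair mulr_sumr; apply: eq_bigr => i _.
  rewrite !mulr_sumr; apply: eq_bigr => j _.
  rewrite !mulr_sumr; apply: eq_bigr => r _.
  by rewrite /u /s /=; ring.
rewrite rkhs_norm_atomic /sum_entries mulr_sumr.
have ccE p q : c p * c q * tensor3 k l m (s p) (s q) = \sum_a \sum_b
    (n%:R ^+ 2)^-1 * (u a p * u b q * tensor3 k l m (s p) (s q)).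
  rewrite /c (mulrACA n%:R^-1) big_distrlr /= mulr_sumr mulr_suml.
  apply: eq_bigr => a _; rewrite mulr_sumr mulr_suml.
  by apply: eq_bigr => b _; rewrite -exprVn expr2 !mulrA.
(* The sums over [a] and [b] hidden in the coefficients move outside, where they match
   [sum_entries]. *)
transitivity (\sum_a \sum_b \sum_p \sum_q
    (n%:R ^+ 2)^-1 * (u a p * u b q * tensor3 k l m (s p) (s q))).
  under eq_bigr => p _.
    under eq_bigr do rewrite ccE.
    rewrite exchange_big; over.
  rewrite exchange_big; apply: eq_bigr => a _.
  under eq_bigr do rewrite exchange_big.
  exact: exchange_big.
apply: eq_bigr => a _; rewrite mulr_sumr; apply: eq_bigr => b _.
(* The first use of [mul3_sum] gathers the three row indices into [p], the second the three column
   indices into [q]. *)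
rewrite 2![hadamard _ _ a b]mxE !centeredE mul3_sum mulr_sumr;
apply: eq_bigr => p _.
rewrite mul3_sum mulr_sumr; apply: eq_bigr => q _.
by rewrite 3![gram _ _ _ _]mxE /u /s /tensor3 /h /=; ring.
Qed.
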